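(* For every positive integer $n$ (treated as a constant), the $n$-dimensional oriented grid can be explored by (1) $4$ synchronous agents with exploration cost $O(V(D)^2)$, and (2) $5$ semi-synchronous agents with exploration cost $O(V(D)^3)$, where a treasure is hidden at an unknown cell at $\ell_1$-distance $D$ from the origin and $V(D)=\Theta(D^n)$ is the number of cells of the $\ell_1$-ball of radius $D$ around the origin.
   Context: The $n$-dimensional grid has vertex set (cells) $\mathbb{Z}^n$; two cells are adjacent if they differ by exactly $1$ in exactly one coordinate; distance is the $\ell_1$ (Manhattan) distance. The grid is oriented: an agent can move in any of the $2n$ global directions $(\pm1,i)$ or stay. Agents all start at the origin, cannot distinguish cells, and each is governed by the same deterministic finite automaton with state set $Q$ (possibly different initial states), with transition function $\delta: Q\times 2^Q\to Q\times(\{-1,+1\}\times\{0,1,\dots,n\})$: an agent observes the set of states of agents in its cell and chooses a new state and a move (dimension $0$ meaning stay). Time proceeds in discrete steps; each active agent performs one atomic look-compute-move cycle per step. In the synchronous model all agents are active every step; in the semi-synchronous model an adversary chooses the active subset each step, subject to each agent being active infinitely often. The task is to find a treasure hidden in some cell at distance $D$ from the origin ($D$ unknown to the agents). In the synchronous model the exploration cost is the number of time steps until some agent reaches the treasure's cell; in the semi-synchronous model it is the total distance traveled by all agents until then. *)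

(* Defs.v *)
From HB Require Import structures.
From mathcomp Require Import all_boot all_order all_algebra.
Set Implicit Arguments. Unset Strict Implicit. Unset Printing Implicit Defensive.
Import Order.TTheory GRing.Theory Num.Theory.

Definition cell (n : nat) := {ffun 'I_n -> int}.
Definition origin (n : nat) : cell n := [ffun _ => 0%R].

Definition dist (n : nat) (p : cell n) : nat := \sum_(i < n) absz (p i).

(* V(D) = number of cells of the l1-ball of radius D around the origin;
   a cell x with |x|_1 <= D has coordinates in [-D, D], encoded as v - D with
   v in {0, ..., 2D}. *)
Definition ballV (n D : nat) : nat :=
  #|[set v : {ffun 'I_n -> 'I_(2 * D + 1)} |
      (\sum_(i < n) absz (Posz (nat_of_ord (v i)) - Posz D)%R <= D)%N]|.

Definition move (n : nat) := option (bool * 'I_n).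

Definition shift (n : nat) (p : cell n) (m : move n) : cell n :=
  match m with
  | None => p
  | Some (b, d) =>
      [ffun i => if i == d then (if b then p i + 1 else p i - 1)%R else p i]
  end.

Definition move_len (n : nat) (m : move n) : nat := if m is Some _ then 1 else 0.

Definition automaton (n : nat) (Q : finType) := Q -> {set Q} -> Q * move n.

Definition config (n : nat) (Q : finType) (k : nat) :=
  (('I_k -> cell n) * ('I_k -> Q))%type.

Definition observe (n : nat) (Q : finType) (k : nat) (c : config n Q k)
    (i : 'I_k) : {set Q} :=
  [set c.2 j | j in [set j : 'I_k | c.1 j == c.1 i]].

Definition step (n : nat) (Q : finType) (k : nat) (delta : automaton n Q)
    (A : {set 'I_k}) (c : config n Q k) : config n Q k :=
  (fun i => if i \in A then shift (c.1 i) (delta (c.2 i) (observe c i)).2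
            else c.1 i,
   fun i => if i \in A then (delta (c.2 i) (observe c i)).1 else c.2 i).

Fixpoint run (n : nat) (Q : finType) (k : nat) (delta : automaton n Q)
    (init : 'I_k -> Q) (sched : nat -> {set 'I_k}) (t : nat) : config n Q k :=
  match t with
  | 0 => (fun _ => origin n, init)
  | t'.+1 => step delta (sched t') (run delta init sched t')
  end.

Definition step_cost (n : nat) (Q : finType) (k : nat) (delta : automaton n Q)
    (init : 'I_k -> Q) (sched : nat -> {set 'I_k}) (s : nat) : nat :=
  let c := run delta init sched s in
  \sum_(i in sched s) move_len (delta (c.2 i) (observe c i)).2.

Definition total_cost (n : nat) (Q : finType) (k : nat) (delta : automaton n Q)
    (init : 'I_k -> Q) (sched : nat -> {set 'I_k}) (t : nat) : nat :=
  \sum_(s < t) step_cost delta init sched s.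

Definition sync_sched (k : nat) : nat -> {set 'I_k} := fun _ => setT.

Definition fair (k : nat) (sched : nat -> {set 'I_k}) : Prop :=
  forall (i : 'I_k) (t : nat), exists t', (t <= t')%N /\ i \in sched t'.

Definition found (n : nat) (Q : finType) (k : nat) (delta : automaton n Q)
    (init : 'I_k -> Q) (sched : nat -> {set 'I_k}) (x : cell n) (t : nat) : Prop :=
  exists i : 'I_k, (run delta init sched t).1 i = x.

(* Main.v *)
From HB Require Import structures.
Require Import Defs.
From mathcomp Require Import all_boot all_order all_algebra.
From mathcomp Require Import zify.
Set Implicit Arguments. Unset Strict Implicit. Unset Printing Implicit Defensive.
Import Order.TTheory GRing.Theory Num.Theory.

(* One agent leads, the others are pebbles that move only when the leader, in
   the same cell, orders them to; the leader then waits until the pebble has left, so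
   every fair schedule produces the same sequence of configurations. The group sits on a
   line parallel to the first axis: the pebble [Base] at the current cell p, and [Mark] at
   distance s from it, which stores a counter s. The leader copies s to the
   pebble [Work], reads its ternary digits by repeated division by 3 while running a
   finite automaton over them, moves the whole group one cell in the direction that the
   automaton outputs, increments s, and starts again. The automaton is chosen so that
   the group follows Peano curves: when s = 3^(nk) + N with N < 3^(nk), it performs step N of
   the Peano curve of the cube of side 3^k, with all directions negated for odd k. Consecutive cubes extend in
   opposite directions from a common corner, so the ball of radius D is covered while
   s = O(V(D)).
   Semi-synchronously, the division by 3 uses a fourth pebble [Aux] for the quotient and
   costs O(s^2) moves, which gives O(V^3) in total. Synchronously it takes time O(s),
   hence O(V^2) in total, because the fourth pebble is not needed: [Work] walks
   towards [Base] at speed 1/2 while the leader runs to [Base] and back; with a pause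
   equal to the remainder they meet exactly at the quotient. *)

(** * Peano curves driven by a finite automaton *)

Section DigitWalk.
Variables (n : nat) (F : Type) (fs : F -> 'I_3 -> F) (out : F -> move n) (f0 : F).

(** Ternary digits are consumed from the lowest one up, without leading zeros, exactly as repeated
    division by 3 delivers them. Fuel [w] suffices because [w %/ 3 < w] for positive [w]. *)
Fixpoint digits_rec (fuel : nat) (f : F) (w : nat) : F :=
  if fuel is u.+1 then
    if w == 0 then f else digits_rec u (fs f (inord (w %% 3))) (w %/ 3)
  else f.

Definition digits f w := digits_rec w f w.

Lemma digits_rec_fuel u w f : w <= u -> digits_rec u f w = digits f w.
Proof.
have H v : forall u u' w f, w <= v -> w <= u -> w <= u' ->
    digits_rec u f w = digits_rec u' f w.
  elim: v => [|v IH] u1 u2 w1 f1; first by rewrite leqn0 => /eqP ->; case: u1; case: u2.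
  case: u1 u2 => [|u1] [|u2] //=; rewrite ?leqn0.
  - by move=> _ /eqP ->.
  - by move=> _ _ /eqP ->.
  - by case: eqP => // w0 H1 H2 H3; apply: IH; lia.
by move=> wu; apply: (H w).
Qed.

Lemma digitsE f w : 0 < w -> digits f w = digits (fs f (inord (w %% 3))) (w %/ 3).
Proof.
by case: w => // w _; rewrite {1}/digits /= digits_rec_fuel //; lia.
Qed.

(** The same run with the highest digit as the outermost application, so that it matches the
    recursions of [scanned] and [peano]. *)
Fixpoint msd_fold m f w :=
  if m is m'.+1 then fs (msd_fold m' f w) (inord ((w %/ 3 ^ m') %% 3)) else f.

Lemma msd_foldS m f w :
  msd_fold m.+1 f w = msd_fold m (fs f (inord (w %% 3))) (w %/ 3).
Proof.
elim: m f => [|m IH] f; first by rewrite /= expn0 divn1.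
by rewrite -[LHS]/(fs (msd_fold m.+1 f w) _) IH /= -divnMA -expnS.
Qed.

Lemma digits_msd m f w : 3 ^ m <= w < 3 ^ m.+1 -> digits f w = msd_fold m.+1 f w.
Proof.
elim: m f w => [|m IH] f w.
  by rewrite expn0 expn1 msd_foldS => /andP[w0 w3]; rewrite digitsE // divn_small.
move=> /andP[H1 H2]; have w0 : 0 < w by apply: leq_trans H1; rewrite expn_gt0.
rewrite digitsE // msd_foldS; apply: IH.
by rewrite leq_divRL // ltn_divLR // -!expnSr H1.
Qed.

(* The position of the group when the counter holds [t + 1]. *)
Fixpoint walk (t : nat) : cell n :=
  if t is t'.+1 then shift (walk t') (out (digits f0 t'.+1)) else origin n.

End DigitWalk.

(** * The Peano curve of a box and its steps *)

Section Curve.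
Variables (n : nat) (hn : 0 < n).
Let i0 : 'I_n := Ordinal hn.

Definition level := ('I_n * bool)%type.
(** Digit j belongs to the level whose coordinate is j mod n and whose boolean is the parity of j /
    n; the parity flips when the coordinate wraps around to 0. *)
Definition next_level (l : level) : level := (ordS l.1, l.2 (+) (ordS l.1 == i0)).
Definition nth_level j : level := iter j next_level (i0, false).

(* Coordinate and sign (true for -1) of a step of the Peano curve. The lowest digit
   different from 2 decides the coordinate; every higher digit 1 that belongs to another
   coordinate flips the sign, because the middle copy of the curve is reflected. *)
Definition turn := option ('I_n * bool).
Definition scan (st : level * turn) (d : nat) : level * turn :=
  (next_level st.1,
   if st.2 is Some (c, s) then Some (c, s (+) ((d == 1) && (c != st.1.1)))
   else if d == 2 then None else Some (st.1.1, false)).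

Definition dig (k N : nat) := (N %/ 3 ^ k) %% 3.

Fixpoint scanned (k N : nat) : level * turn :=
  if k is k'.+1 then scan (scanned k' N) (dig k' N) else ((i0, false), None).

Fixpoint side (k : nat) (i : 'I_n) : nat :=
  if k is k'.+1 then (if i == (nth_level k').1 then 3 else 1) * side k' i else 1.

(** Point N of the curve filling the box with sides [side k]. Each digit stacks three copies of the
    previous box along one coordinate; the middle copy is reflected in all other coordinates, so
    that consecutive copies join up. *)
Fixpoint peano (k N : nat) (i : 'I_n) : nat :=
  if k is k'.+1 then
    if i == (nth_level k').1 then dig k' N * side k' i + peano k' N i
    else if dig k' N == 1 then side k' i - (peano k' N i).+1 else peano k' N i
  else 0.

Lemma scanned_level k N : (scanned k N).1 = nth_level k.
Proof. by elim: k => //= k ->. Qed.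

Lemma val_nth_level j : (nth_level j).1 = j %% n :> nat.
Proof.
elim: j => [|j IH] /=; first by rewrite mod0n.
by rewrite IH -addn1 modnDml addn1.
Qed.

Lemma nth_levelS j : nth_level j.+1 = next_level (nth_level j). Proof. by []. Qed.

Lemma nth_level_par k r : r < n -> (nth_level (n * k + r)).2 = odd k.
Proof.
have S1 j : (nth_level j.+1).2 = (nth_level j).2 (+) (n %| j.+1).
  have H : ordS (nth_level j).1 = j.+1 %% n :> nat := val_nth_level j.+1.
  rewrite nth_levelS -[LHS]/((nth_level j).2 (+) (ordS (nth_level j).1 == i0)).
  by rewrite -val_eqE [val _]H.
have low u v : v < n -> (nth_level (n * u + v)).2 = (nth_level (n * u)).2.
  elim: v => [|v IH] vn; first by rewrite addn0.
  rewrite addnS S1 IH; last exact: ltnW.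
  by rewrite -addnS dvdn_addr ?dvdn_mulr // gtnNdvd // addbF.
move=> rn; rewrite low //; elim: k => [|k IH]; first by rewrite muln0.
have E : n * k.+1 = (n * k + n.-1).+1 by rewrite mulnS; lia.
by rewrite E S1 low ?prednK // IH -E dvdn_mulr ?addbT.
Qed.

Lemma nth_level_block k : nth_level (n * k) = (i0, odd k).
Proof.
rewrite [LHS]surjective_pairing -{2}[n * k]addn0 nth_level_par //.
by congr pair; apply: val_inj; rewrite [LHS]val_nth_level modnMr.
Qed.

Lemma side_block_add k r i :
  r <= n -> side (n * k + r) i = (if i < r then 3 else 1) * side (n * k) i.
Proof.
elim: r => [|r IHr] rn; first by rewrite addn0 mul1n.
rewrite addnS /= IHr; last exact: ltnW.
rewrite -val_eqE [val (nth_level _).1]val_nth_level [n * k]mulnC modnMDl modn_small // ltnS /=.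
by case: (ltngtP i r) => //= _; rewrite ?mul1n.
Qed.

Lemma side_block k i : side (n * k) i = 3 ^ k.
Proof.
elim: k => [|k IH]; first by rewrite muln0.
by rewrite mulnS addnC side_block_add // ltn_ord IH expnS.
Qed.

Lemma side_gt0 k i : 0 < side k i.
Proof. by elim: k => //= k IH; rewrite muln_gt0 IH; case: ifP. Qed.

Lemma peano_lt k N i : peano k N i < side k i.
Proof.
elim: k => //= k IH; have d3 : dig k N < 3 by rewrite ltn_mod.
case: eqP => _; last by rewrite mul1n; case: eqP => _ //; lia.
by nia.
Qed.

Lemma dig_low j k d N : j < k -> dig j (d * 3 ^ k + N) = dig j N.
Proof.
move=> jk; rewrite /dig.
have -> : d * 3 ^ k = (d * 3 ^ (k - j.+1) * 3) * 3 ^ j.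
  by rewrite -!mulnA -expnS -expnD; congr (_ * 3 ^ _); lia.
by rewrite divnMDl ?expn_gt0 // modnMDl.
Qed.

Lemma dig_top k d N : d < 3 -> N < 3 ^ k -> dig k (d * 3 ^ k + N) = d.
Proof.
by move=> d3 Nk; rewrite /dig divnMDl ?expn_gt0 // divn_small // addn0 modn_small.
Qed.

Lemma peano_low k d N i : peano k (d * 3 ^ k + N) i = peano k N i.
Proof.
suff H j : j <= k -> peano j (d * 3 ^ k + N) i = peano j N i by apply: H.
by elim: j => //= j IH jk; rewrite IH ?dig_low //; lia.
Qed.

Lemma scanned_low k d N : scanned k (d * 3 ^ k + N) = scanned k N.
Proof.
suff H j : j <= k -> scanned j (d * 3 ^ k + N) = scanned j N by apply: H.
by elim: j => //= j IH jk; rewrite IH ?dig_low //; lia.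
Qed.

Lemma peano0 k i : peano k 0 i = 0.
Proof.
elim: k => //= k IH; rewrite IH /dig div0n mod0n /=.
by case: ifP.
Qed.

Lemma peano_last k N : N.+1 = 3 ^ k ->
  (scanned k N).2 = None /\ forall i, (peano k N i).+1 = side k i.
Proof.
elim: k N => [|k IH] N; first by rewrite expn0.
have k0 : 0 < 3 ^ k by rewrite expn_gt0.
rewrite expnS => NE.
have -> : N = 2 * 3 ^ k + (3 ^ k).-1 by lia.
have [I1 I2] := IH (3 ^ k).-1 ltac:(lia).
rewrite /= !scanned_low !dig_top //; last by lia.
rewrite I1 /=; split=> // i; rewrite peano_low.
by move: (I2 i); case: eqP => _; lia.
Qed.

(** Adding 1 to N carries through the trailing digits 2, so the lowest other digit decides the
    coordinate. The sign appears as a summand on either side to avoid truncated subtraction. *)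
Lemma peano_step k N : N.+1 < 3 ^ k ->
  exists c s, (scanned k N).2 = Some (c, s) /\
    forall i, peano k N.+1 i + (s && (i == c)) = peano k N i + (~~ s && (i == c)).
Proof.
elim: k N => [|k IH] N; first by rewrite expn0.
have k0 : 0 < 3 ^ k by rewrite expn_gt0.
rewrite expnS => Nk.
rewrite (divn_eq N (3 ^ k)); set d := N %/ _; set r := N %% _.
have rk : r < 3 ^ k by rewrite ltn_mod.
have d3 : d < 3 by rewrite ltn_divLR //; lia.
have Ne : N = d * 3 ^ k + r by exact: divn_eq.
(* Either the step stays inside one copy, and is reversed if the copy is reflected in its
   coordinate, or [r] is the last point of its copy. *)
have [rk1|rk1] := ltnP r.+1 (3 ^ k).
  have [c [s [cs H]]] := IH r rk1.
  rewrite -addnS /= scanned_low !dig_top // cs.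
  eexists; eexists; split; first by [].
  move=> i; move: (H i); rewrite !peano_low scanned_level; move: (nth_level k).1 => e {}H.
  have := peano_lt k r i; have := peano_lt k r.+1 i.
  case: (altP (i =P c)) H => [ic|ic]; last first.
    by rewrite !andbF; case: eqP => // _; [lia|case: eqP => //; lia].
  case: (altP (i =P e)) => [ie|ie]; rewrite -ic.
    by rewrite -ie eqxx andbF addbF; case: (s); lia.
  by rewrite ie; case: eqP => _; case: (s) => /=; lia.
(* Crossing to the next copy: exactly one of the two is the reflected middle copy, so all
   coordinates but the stacking one agree, and that one grows by 1. *)
have re : r.+1 = 3 ^ k by lia.
have d2 : d < 2 by nia.
have [I1 I2] := peano_last re.
have E : (d * 3 ^ k + r).+1 = d.+1 * 3 ^ k + 0 by lia.
rewrite /= scanned_low dig_top // I1 E !dig_top //.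
exists (nth_level k).1, false; split; first by rewrite scanned_level; case: d d2 {d3 Ne E} => [|[]].
move=> i; rewrite !peano_low peano0 /=; move: (I2 i).
case: eqP => _; rewrite ?addn0 ?addn1; first by lia.
by case: d d2 {d3 Ne E} => [|[|]] //= _; lia.
Qed.

Lemma peano_onto k (y : 'I_n -> nat) : (forall i, y i < side k i) ->
  exists2 N, N < 3 ^ k & forall i, peano k N i = y i.
Proof.
elim: k y => [|k IH] y H.
  by exists 0 => // i; move: (H i) => /=; case: (y i).
set c := (nth_level k).1; set d := y c %/ side k c.
have d3 : d < 3 by rewrite ltn_divLR ?side_gt0 //; move: (H c) => /=; rewrite eqxx.
(* The quotient in the stacking coordinate is the top digit; in the middle copy the other
   coordinates are reflected back before recursing. *)
have [|N Nk HN] := IH (fun i => if i == c then y c %% side k c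
                        else if d == 1 then side k i - (y i).+1 else y i).
  move=> i; move: (H i) (side_gt0 k i) => /=; rewrite -/c.
  case: eqP => [->|_]; first by rewrite ltn_mod.
  by case: eqP => _; lia.
exists (d * 3 ^ k + N); first by rewrite expnS; nia.
move=> i; rewrite /= dig_top // peano_low HN -/c.
case: eqP => [->|ic]; first by rewrite {2}(divn_eq (y c) (side k c)).
by move: (H i) => /=; case: eqP => // _; case: eqP => // _; lia.
Qed.


(** * The output automaton and the chain of growing cubes *)

Definition curve_state := ((level * turn) * option 'I_3)%type.

(* Runs one digit late, so that the leading digit is kept apart from the others. *)
Definition curve_step (f : curve_state) (d : 'I_3) : curve_state :=
  (if f.2 is Some e then scan f.1 e else f.1, Some d).

Definition curve_start : curve_state := ((i0, false), None, None).

(** The group moves only if the leading digit is 1 and the number of lower digits is a multiple nk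
    of n, that is, if the counter is 3^(nk) + N. The parity [l.2] of k then reverses the direction.
    In a turn true means -1, in a move it means +1. *)
Definition curve_out (f : curve_state) : move n :=
  if f is ((l, Some (c, s)), Some d) then
    if (d == 1 :> nat) && (l.1 == i0) then Some (s == l.2, c) else None
  else None.

Lemma curve_digits m w : 3 ^ m <= w < 3 ^ m.+1 ->
  digits curve_step curve_start w = (scanned m w, Some (inord (dig m w))).
Proof.
move=> mw; rewrite (digits_msd _ _ mw).
elim: m {mw} => [|m IH] //.
have -> : msd_fold curve_step m.+2 curve_start w =
  curve_step (msd_fold curve_step m.+1 curve_start w) (inord (dig m.+1 w)) by [].
by rewrite IH /curve_step /= inordK // ltn_mod.
Qed.

Definition curve := walk curve_step curve_out curve_start.

Lemma curveS t : curve t.+1 = shift (curve t) (curve_out (digits curve_step curve_start t.+1)).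
Proof. by []. Qed.

Definition sgn (k : nat) : int := if odd k then (-1)%R else 1%R.

Fixpoint corner (k : nat) : int :=
  if k is k'.+1 then (corner k' + sgn k' * (Posz (3 ^ k') - 1))%R else 0%R.

(** Cube k starts about a quarter of its side away from the origin, opposite to the direction in
    which it extends. It thus reaches at least (3^k - 3) / 4 to the near side and about three
    quarters of its side to the other. *)
Lemma corner_bounds k :
  (Posz (3 ^ k) - 3 <= - (4 * (sgn k * corner k)) <= Posz (3 ^ k) - 1)%R.
Proof.
elim: k => [//|k IH].
rewrite /= /sgn /= expnS; move: IH; rewrite /sgn.
by case: (odd k) => /=; lia.
Qed.

Lemma curve_move k N i : N.+1 < 3 ^ (n * k) ->
  (curve (3 ^ (n * k) + N) i = curve (3 ^ (n * k) + N).-1 i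
     + sgn k * (Posz (peano (n * k) N.+1 i) - Posz (peano (n * k) N i)))%R.
Proof.
set m := n * k; move=> Nk; have m0 : 0 < 3 ^ m by rewrite expn_gt0.
have E : 3 ^ m + N = (3 ^ m + N).-1.+1 by lia.
have [c [s [cs H]]] := peano_step Nk.
rewrite {1}E curveS -E (@curve_digits m); last by rewrite expnS; lia.
have D1 : dig m (3 ^ m + N) = 1 by rewrite -[3 ^ m]mul1n dig_top //; lia.
have Sm : scanned m (3 ^ m + N) = scanned m N by rewrite -[X in X + N]mul1n scanned_low.
rewrite D1 Sm; have := scanned_level m N; case: (scanned m N) cs => l t /= -> ->.
rewrite inordK //= nth_level_block eqxx /= ffunE /sgn.
move: (H i); case: (i == c); last by rewrite !andbF /=; case: (odd k); lia.
by case: (s); case: (odd k) => /=; lia.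
Qed.

(** Three reasons for silence: all lower digits are 2 and no turn is found, the leading digit is 2,
    or the number of lower digits lies strictly between nk and n(k+1). *)
Lemma curve_idle k w : (3 ^ (n * k) * 2).-1 <= w < 3 ^ (n * k.+1) ->
  curve w = curve w.-1.
Proof.
set m0 := n * k => wk; have p0 : 0 < 3 ^ m0 by rewrite expn_gt0.
have w0 : 0 < w by lia.
have := trunc_log_bounds (isT : 1 < 3) w0; set m := trunc_log 3 w => mw.
suff Ho : curve_out (digits curve_step curve_start w) = None.
  by rewrite -{1}(prednK w0) curveS (prednK w0) Ho.
rewrite (curve_digits mw) /curve_out.
have ml : m < n * k.+1.
  by rewrite -(ltn_exp2l _ _ (isT : 1 < 3)); case/andP: wk mw => _ w2 /andP[w1 _]; exact: leq_ltn_trans w1 w2.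
have mg : m0 <= m.
  by rewrite -ltnS -(ltn_exp2l _ _ (isT : 1 < 3)); case/andP: mw => _; apply: leq_ltn_trans; lia.
have := scanned_level m w; case Es: (scanned m w) => [l t] /= El.
case: t Es => [[c s]|//] Es.
have [me|mn] := eqVneq m m0; last first.
  suff -> : (l.1 == i0) = false by rewrite andbF.
  rewrite -val_eqE El [val _]val_nth_level; apply/negP => /= /dvdnP[q qE].
  by move: mn ml mg; rewrite qE /m0 ![n * _]mulnC ltn_mul2r leq_mul2r; nia.
case: eqP => // D1.
have D1' : dig m0 w = 1 by rewrite -D1 me inordK // ltn_mod.
have wE : w = 1 * 3 ^ m0 + (w - 3 ^ m0).
  move: mw; rewrite me => ?; lia.
have wl : w - 3 ^ m0 < 3 ^ m0.
  have := divn_eq w (3 ^ m0); have : w %/ 3 ^ m0 < 3 by rewrite ltn_divLR // -expnS -me; case/andP: mw.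
  by move: D1'; rewrite /dig => D2 D3; rewrite modn_small // in D2; rewrite D2; have := ltn_pmod w p0; lia.
have [|Hs _] := @peano_last m0 (w - 3 ^ m0); first by lia.
by move: Es; rewrite me wE scanned_low => Es; rewrite Es in Hs.
Qed.

Lemma curve_block k N i : N < 3 ^ (n * k) ->
  (curve (3 ^ (n * k) + N).-1 i =
     curve (3 ^ (n * k)).-1 i + sgn k * Posz (peano (n * k) N i))%R.
Proof.
elim: N => [|N IH] Nk; first by rewrite addn0 peano0 mulr0 addr0.
by rewrite addnS /= curve_move // IH; [lia|exact: ltnW].
Qed.

Lemma curve_corner k i : curve (3 ^ (n * k)).-1 i = corner k.
Proof.
elim: k => [|k IH]; first by rewrite muln0 expn0 /= ffunE.
have p0 : 0 < 3 ^ (n * k) by rewrite expn_gt0.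
have idle w : (3 ^ (n * k) * 2).-1.-1 <= w < 3 ^ (n * k.+1) ->
    curve w = curve (3 ^ (n * k) * 2).-1.-1.
  elim: w => [|w IHw] Hw; first by congr curve; lia.
  have [->//|wn] := eqVneq w.+1 (3 ^ (n * k) * 2).-1.-1.
  by rewrite (@curve_idle k) /= ?IHw //; lia.
have big : 3 ^ (n * k) * 2 < 3 ^ (n * k.+1).
  by apply: (@leq_trans (3 ^ (n * k).+1)); [rewrite expnS; lia|rewrite leq_exp2l // mulnS; lia].
rewrite idle; last by lia.
(* The first idle counter value is 2 * 3^(nk) - 1, and the position before it is the last point of
   cube k, where cube k+1 starts. *)
have E : (3 ^ (n * k) * 2).-1.-1 = (3 ^ (n * k) + (3 ^ (n * k)).-1).-1 by lia.
rewrite E curve_block; last by lia.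
have [_ H] := @peano_last (n * k) (3 ^ (n * k)).-1 ltac:(lia).
by have := H i; rewrite IH side_block /=; lia.
Qed.

Lemma curve_covers (x : cell n) :
  exists2 t, t < (3 * (4 * dist x + 3)) ^ n * 2 & curve t = x.
Proof.
set D := dist x.
have xD i : (absz (x i) <= D)%N by rewrite /D /dist (bigD1 i) //= leq_addr.
have D1 : 1 < 4 * D + 3 by lia.
(* The least k with 3^k >= 4D + 3 makes the short side (3^k - 3) / 4 at least D; minimality keeps
   3^k below 3(4D + 3). *)
have := up_log_bounds (isT : 1 < 3) D1.
set k := up_log _ _ => /andP[k1 k2].
have kE : 3 ^ k < 3 * (4 * D + 3).
  case: (k) k1 k2 => [|k'] //=; first by rewrite expn0; lia.
  by rewrite expnS; lia.
have B1 := corner_bounds k; have B2 := corner_bounds k.+1.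
have xr i : (0 <= sgn k * (x i - corner k) < Posz (3 ^ k))%R.
  have := xD i; move: B1 B2; rewrite /= {2 3}/sgn /sgn expnS /=.
  by case: (odd k) => /=; lia.
have [|N Nk HN] := @peano_onto (n * k) (fun i => absz (x i - corner k)%R).
  by move=> i; rewrite side_block; have := xr i; rewrite /sgn; case: odd; lia.
exists (3 ^ (n * k) + N).-1.
  have p1 : 3 ^ (n * k) <= (3 * (4 * D + 3)) ^ n.
    by rewrite [n * k]mulnC expnM leq_exp2r // ltnW.
  have p0 : 0 < 3 ^ (n * k) by rewrite expn_gt0.
  by rewrite muln2 -addnn; lia.
apply/ffunP => i; rewrite curve_block // curve_corner HN.
by have := xr i; rewrite /sgn; case: (odd k) => /=; lia.
Qed.

(** The ball contains the box of side D / n (rounded down) in the positive orthant, and D + 1 <= n(q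
    + 1) for this quotient q. The injection adds D because [ballV] encodes coordinates with that
    offset. *)
Lemma ballV_ge D : (D.+1) ^ n <= n ^ n * ballV n D.
Proof.
set q := D %/ n.
have qD : n * q <= D by rewrite mulnC leq_divM.
have n0 := hn.
have qle : q <= D by apply: leq_div.
have ub (u : 'I_q.+1) : D + u < 2 * D + 1 by have := ltn_ord u; lia.
pose g (u : {ffun 'I_n -> 'I_q.+1}) : {ffun 'I_n -> 'I_(2 * D + 1)} :=
  [ffun i => Ordinal (ub (u i))].
have gi : injective g.
  move=> u v /ffunP uv; apply/ffunP => i; apply: val_inj.
  by have := congr1 val (uv i); rewrite !ffunE /= => /addnI.
have : q.+1 ^ n <= ballV n D.
  rewrite -[n in X in X <= _]card_ord -[q.+1]card_ord -card_ffun -cardsT.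
  rewrite -(card_imset setT gi) subset_leq_card //.
  apply/subsetP => _ /imsetP[u _ ->]; rewrite inE.
  apply: leq_trans qD.
  have -> : n * q = \sum_(i < n) q by rewrite sum_nat_const card_ord.
  apply: leq_sum => i _; rewrite ffunE /=.
  by case: (u i) => v /= vq; lia.
move=> H; apply: (@leq_trans (n ^ n * q.+1 ^ n)); last by rewrite leq_mul2l H orbT.
by rewrite -expnMn leq_exp2r // mulnC; exact: ltn_ceil.
Qed.

End Curve.

Lemma curve_exists n : 0 < n ->
  exists (F : finType) (fs : F -> 'I_3 -> F) (out : F -> move n) (f0 : F) (C : nat),
    forall x : cell n, exists2 t, t < C * ballV n (dist x) & walk fs out f0 t = x.
Proof.
move=> hn; exists (curve_state n), (@curve_step n hn), (@curve_out n hn), (curve_start hn).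
(* Here 3(4D + 3) <= 12(D + 1), the factor n^n comes from [ballV_ge], and 2 from the range of the
   counter within a cube. *)
exists (12 ^ n * n ^ n * 2) => x.
have [t tx tE] := curve_covers hn x; exists t => //.
apply: leq_trans tx _; rewrite mulnAC leq_mul2r /= -mulnA.
apply: (@leq_trans (12 ^ n * (dist x).+1 ^ n)); last by rewrite leq_mul2l ballV_ge ?orbT.
by rewrite -expnMn leq_exp2r //; lia.
Qed.

(** * The agents *)

Inductive pebble := Mark | Base | Work | Aux.

Definition pebble_code (j : pebble) : 'I_4 :=
  match j with
  | Mark => @Ordinal 4 0 isT | Base => @Ordinal 4 1 isT
  | Work => @Ordinal 4 2 isT | Aux => @Ordinal 4 3 isT
  end.
Definition pebble_decode (i : 'I_4) : pebble := nth Mark [:: Mark; Base; Work; Aux] i.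
Lemma pebble_codeK : cancel pebble_code pebble_decode.
Proof. by case. Qed.
HB.instance Definition _ := Finite.copy pebble (can_type pebble_codeK).

(* [Strip] to [Rejoin] divide by 3 with [Aux]; [Fire] to [Await] do so by slow walking. *)
Inductive label :=
  | Fetch | FetchStep | Divide
  | Strip | StripStep | ToBase | ToAux | Bump | BackBase | BackWork
  | Meet | MeetStep | Drop | DropStep | Rejoin
  | Fire | Inward | Await
  | ShiftBase | ShiftWork | ShiftAux | ToMark | ShiftMark | Count | Return.

Definition labels := [:: Fetch; FetchStep; Divide;
  Strip; StripStep; ToBase; ToAux; Bump; BackBase; BackWork;
  Meet; MeetStep; Drop; DropStep; Rejoin;
  Fire; Inward; Await;
  ShiftBase; ShiftWork; ShiftAux; ToMark; ShiftMark; Count; Return].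

Definition label_code (l : label) : 'I_25 :=
  inord (match l with
  | Fetch => 0 | FetchStep => 1 | Divide => 2
  | Strip => 3 | StripStep => 4 | ToBase => 5 | ToAux => 6 | Bump => 7 | BackBase => 8
  | BackWork => 9 | Meet => 10 | MeetStep => 11 | Drop => 12 | DropStep => 13 | Rejoin => 14
  | Fire => 15 | Inward => 16 | Await => 17
  | ShiftBase => 18 | ShiftWork => 19 | ShiftAux => 20 | ToMark => 21 | ShiftMark => 22
  | Count => 23 | Return => 24 end).
Definition label_decode (i : 'I_25) : label := nth Fetch labels i.
Lemma label_codeK : cancel label_code label_decode.
Proof. by case; rewrite /label_decode inordK. Qed.
HB.instance Definition _ := Finite.copy label (can_type label_codeK).

Arguments shift : simpl never.

(** * Cells on a line parallel to the first axis *)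

Section Line.
Variables (n : nat) (i0 : 'I_n).

Lemma shift_neq (p : cell n) m : shift p (Some m) != p.
Proof.
case: m => b d; apply/eqP => /ffunP/(_ d); rewrite ffunE eqxx.
by case: b => /= H; lia.
Qed.

Definition forth : bool * 'I_n := (true, i0).
Definition back : bool * 'I_n := (false, i0).

Definition along (p : cell n) (k : nat) : cell n :=
  [ffun i => if i == i0 then (p i + Posz k)%R else p i].

Lemma along0 p : along p 0 = p.
Proof. by apply/ffunP => i; rewrite ffunE addr0; case: eqP. Qed.

Lemma along_forth p k : shift (along p k) (Some forth) = along p k.+1.
Proof. by apply/ffunP => i; rewrite !ffunE; case: eqP => // _; lia. Qed.

Lemma along_back p k : shift (along p k.+1) (Some back) = along p k.
Proof. by apply/ffunP => i; rewrite !ffunE; case: eqP => // _; lia. Qed.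

Lemma along_eq p k k' : (along p k == along p k') = (k == k').
Proof.
apply/eqP/eqP => [/ffunP/(_ i0)|->//]; rewrite !ffunE eqxx; lia.
Qed.

Lemma along_shift p m k : along (shift p m) k = shift (along p k) m.
Proof.
case: m => [[b d]|//]; apply/ffunP => i; rewrite !ffunE.
by case: (i == i0); case: (i == d); case: b => /=; lia.
Qed.

End Line.

Section Places.
Variable T : Type.
(** The entries are cells, or offsets along the line when the whole group is on it. *)
Definition places := (T * T * T * T)%type.
Definition get (P : places) (j : pebble) : T :=
  let: (s, b, w, r) := P in
  match j with Mark => s | Base => b | Work => w | Aux => r end.
Definition put (P : places) (j : pebble) (x : T) : places :=
  let: (s, b, w, r) := P in
  match j with
  | Mark => (x, b, w, r) | Base => (s, x, w, r)
  | Work => (s, b, x, r) | Aux => (s, b, w, x)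
  end.
Lemma get_put P j x j' : get (put P j x) j' = if j' == j then x else get P j'.
Proof. by move: P => [[[s b] w] r]; case: j; case: j'. Qed.
Lemma put_put P j x y : put (put P j x) j y = put P j y.
Proof. by move: P => [[[s b] w] r]; case: j. Qed.
Lemma put_get P j : put P j (get P j) = P.
Proof. by move: P => [[[s b] w] r]; case: j. Qed.
End Places.

(** * The leader's program and the pebbles' reactions *)

Section Machine.
Variables (n : nat) (i0 : 'I_n) (F : finType) (fs : F -> 'I_3 -> F).
Variables (out : F -> move n) (f0 : F) (sy : bool).

Local Notation forth := (forth i0).
Local Notation back := (back i0).

Definition control := (label * F * 'I_3)%type.
Definition action := (control * move n)%type.

(* A [Push] with continuation [a] takes effect once the pebble has left the cell. *)
Inductive instruction :=
  | Test of pebble & action & action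
  | Push of pebble & bool * 'I_n & action
  | Launch of action.

Definition at_label (l : label) (f : F) : control := (l, f, ord0).

(** The third component counts modulo 3 the cells removed ([Strip]) or walked ([Inward]), and in
    [Await] the pause still due. A [Test] with equal branches is a plain jump; the pause tests
    [Base] since a [Test Work] is the signal that stops a walking [Work]. *)
Definition program (q : control) : instruction :=
  let: (l, f, r) := q in
  let goto l' : action := (at_label l' f, None) in
  let forth_to l' : action := (at_label l' f, Some forth) in
  let back_to l' : action := (at_label l' f, Some back) in
  match l with
  | Fetch => Test Mark (at_label Divide f0, None) (goto FetchStep)
  | FetchStep => Push Work forth (forth_to Fetch)
  | Divide => Test Base (goto ShiftBase) (if sy then goto Fire else goto Strip)
  | Strip => Test Base (at_label Meet (fs f r), None) ((StripStep, f, r), None)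
  | StripStep => Push Work back
      (if r == 2 :> nat then at_label ToBase f else (Strip, f, inord r.+1), Some back)
  | ToBase => Test Base (goto ToAux) (back_to ToBase)
  | ToAux => Test Aux (goto Bump) (forth_to ToAux)
  | Bump => Push Aux forth (goto BackBase)
  | BackBase => Test Base (goto BackWork) (back_to BackBase)
  | BackWork => Test Work (goto Strip) (forth_to BackWork)
  | Meet => Test Aux (goto Drop) (goto MeetStep)
  | MeetStep => Push Work forth (forth_to Meet)
  | Drop => Test Base (goto Rejoin) (goto DropStep)
  | DropStep => Push Aux back (back_to Drop)
  | Rejoin => Test Work (goto Divide) (forth_to Rejoin)
  | Fire => Launch ((Inward, f, inord 1), Some back)
  | Inward => Test Base ((Await, fs f r, r), None)
                ((Inward, f, inord (r.+1 %% 3)), Some back)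
  | Await => if r == 0 :> nat then Test Work (goto Divide) (forth_to Await)
             else Test Base ((Await, f, inord r.-1), None) ((Await, f, inord r.-1), None)
  | ShiftBase => if out f is Some m then Push Base m (goto ShiftWork)
                 else Test Base (goto ToMark) (goto ToMark)
  | ShiftWork => if out f is Some m then Push Work m (goto (if sy then ToMark else ShiftAux))
                 else Test Base (goto ToMark) (goto ToMark)
  | ShiftAux => if out f is Some m then Push Aux m (goto ToMark)
                else Test Base (goto ToMark) (goto ToMark)
  | ToMark => Test Mark (goto (if out f is Some _ then ShiftMark else Count)) (forth_to ToMark)
  | ShiftMark => if out f is Some m then Push Mark m (at_label Count f, Some m)
                 else Test Base (goto Count) (goto Count)
  | Count => Push Mark forth (goto Return)
  | Return => Test Base (at_label Fetch f0, None) (back_to Return)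
  end.

(* A pebble in phase [None] obeys the leader; otherwise it walks back at half speed,
   moving in phase [Some true] and pausing in phase [Some false]. *)
Definition astate := (control + pebble * option bool)%type.

Definition agents : automaton n astate := fun x V =>
  let leader := [pick q | inl q \in V] in
  match x with
  | inl q =>
      let sees j := [exists ph, inr (j, ph) \in V] in
      match program q with
      | Test j a b => let: (q', m) := if sees j then a else b in (inl q', m)
      | Push j _ a => if sees j then (x, None) else (inl a.1, a.2)
      | Launch a => (inl a.1, a.2)
      end
  | inr (j, None) =>
      match omap program leader with
      | Some (Push j' m _) => if j' == j then (x, Some m) else (x, None)
      | Some (Launch _) => (inr (j, if j == Work then Some true else None), None)
      | _ => (x, None)
      end
  | inr (j, Some false) => (inr (j, Some true), None)
  | inr (j, Some true) =>
      match omap program leader with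
      | Some (Test Work _ _) => (inr (j, None), None)
      | _ => (inr (j, Some false), Some back)
      end
  end.

Arguments agents : simpl never.

Definition team := if sy then 4 else 5.

Definition role (i : 'I_team) : option pebble :=
  match nat_of_ord i with
  | 0 => None | 1 => Some Mark | 2 => Some Base | 3 => Some Work | _ => Some Aux
  end.

Definition present (j : pebble) := (j == Aux) ==> ~~ sy.

Lemma role_inj : injective role.
Proof.
rewrite /role /team => -[m Hm] [m' Hm'] /= E; apply: val_inj => /=.
have : m < 5 by case: sy Hm => // /leq_trans ->.
have : m' < 5 by case: sy Hm' => // /leq_trans ->.
by case: m m' E {Hm Hm'} => [|[|[|[|[|m]]]]] [|[|[|[|[|m']]]]].
Qed.

Lemma role_leader : exists i, role i = None.
Proof.
by rewrite /role /team; case: sy; [exists (@Ordinal 4 0 isT) | exists (@Ordinal 5 0 isT)].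
Qed.

Lemma role_onto j : present j -> exists i, role i = Some j.
Proof.
rewrite /present /role /team; case: sy; case: j => // _.
- by exists (@Ordinal 4 1 isT).
- by exists (@Ordinal 4 2 isT).
- by exists (@Ordinal 4 3 isT).
- by exists (@Ordinal 5 1 isT).
- by exists (@Ordinal 5 2 isT).
- by exists (@Ordinal 5 3 isT).
- by exists (@Ordinal 5 4 isT).
Qed.

Lemma role_present i j : role i = Some j -> present j.
Proof.
case: i => m; rewrite /present /role /team; case: sy => /= Hm; last by rewrite implybT.
by case: m Hm => [|[|[|[|m]]]] // _ [<-].
Qed.

(** In the synchronous team nobody plays [Aux], so its entry in [P] is a dummy. *)
Definition conf (q : control) (L : cell n) (P : places (cell n)) (ph : option bool) :
    config n astate team :=
  (fun i => if role i is Some j then get P j else L,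
   fun i => if role i is Some j then inr (j, if j == Work then ph else None) else inl q).

Lemma observe_leader q L P ph i q' :
  (inl q' \in observe (conf q L P ph) i) = (q' == q) && (L == (conf q L P ph).1 i).
Proof.
apply/imsetP/andP => [[i' + +]|[/eqP -> Li]].
  by rewrite inE /conf /=; case: (role i') => // /eqP <- [<-]; rewrite !eqxx.
have [i' Hi'] := role_leader; exists i'; last by rewrite /= Hi'.
by rewrite inE; move: Li; rewrite /= Hi'.
Qed.

Lemma observe_pebble q L P ph i j :
  [exists ph', inr (j, ph') \in observe (conf q L P ph) i] =
    present j && (get P j == (conf q L P ph).1 i).
Proof.
apply/existsP/andP => [[ph' /imsetP[i' + +]]|[/role_onto[i' Hi'] Pj]].
  rewrite inE /conf /=; case E: (role i') => [j'|] // Hj [-> _].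
  by split=> //; exact: role_present E.
exists (if j == Work then ph else None); apply/imsetP; exists i'; last by rewrite /= Hi'.
by rewrite inE [X in X == _]/= Hi'.
Qed.

Lemma pick_leader q L P ph i :
  [pick q' | inl q' \in observe (conf q L P ph) i] =
    if L == (conf q L P ph).1 i then Some q else None.
Proof.
case: pickP => [q'|/(_ q)]; rewrite observe_leader; first by case/andP => /eqP -> ->.
by rewrite eqxx /=; case: eqP.
Qed.

(** * Reachable configurations and their cost *)

Section Reach.
Variables (init : 'I_team -> astate) (sched : nat -> {set 'I_team}) (clk : nat -> nat).

Definition ceq (c c' : config n astate team) := c.1 =1 c'.1 /\ c.2 =1 c'.2.

Definition idle (c : config n astate team) i :=
  agents (c.2 i) (observe c i) = (c.2 i, None).

Lemma observe_ceq c c' i : ceq c c' -> observe c i = observe c' i.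
Proof.
case=> H1 H2; apply/setP => x.
by apply/imsetP/imsetP => -[j + ->]; rewrite inE => Hj; exists j; rewrite ?H2 // inE ?H1 // -!H1.
Qed.

Lemma step_ceq A c c' : ceq c c' -> ceq (step agents A c) (step agents A c').
Proof.
move=> H; have [H1 H2] := H.
by split=> i /=; rewrite ?H1 ?H2 (observe_ceq _ H).
Qed.

Lemma ceq_trans c1 c2 c3 : ceq c1 c2 -> ceq c2 c3 -> ceq c1 c3.
Proof. by case=> A1 A2 [B1 B2]; split=> i; rewrite ?A1 ?A2. Qed.

(* [clk] is elapsed time for synchronous agents, and travelled distance for
   semi-synchronous ones. *)
Definition reach (c c' : config n astate team) (k : nat) :=
  forall t, ceq (run agents init sched t) c ->
    exists2 t', ceq (run agents init sched t') c' & clk t' <= clk t + k.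

Lemma reach_trans c2 c1 c3 k1 k2 k :
  reach c1 c2 k1 -> reach c2 c3 k2 -> k1 + k2 <= k -> reach c1 c3 k.
Proof.
move=> H1 H2 Hk t Ht; have [t1 Ht1 L1] := H1 t Ht; have [t2 Ht2 L2] := H2 t1 Ht1.
by exists t2 => //; lia.
Qed.

Lemma reach_le c1 c2 k1 k : reach c1 c2 k1 -> k1 <= k -> reach c1 c2 k.
Proof. by move=> H Hk t /H[t' ? ?]; exists t' => //; lia. Qed.

Lemma reach_ceq c1 c2 c2' k : ceq c2 c2' -> reach c1 c2 k -> reach c1 c2' k.
Proof.
by move=> E H t /H[t' Ht' ?]; exists t' => //; apply: ceq_trans Ht' E.
Qed.

Lemma reach_refl c : reach c c 0.
Proof. by move=> t Ht; exists t; rewrite ?addn0. Qed.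

Hypothesis sched_fair : fair sched.
(** The property shared by both clocks: a step in which only agent [i] can act costs at most 1, and
    nothing if [i] is not activated. *)
Hypothesis clk_idle : forall t i c, ceq (run agents init sched t) c ->
  (forall i', i' != i -> idle c i') -> clk t.+1 <= clk t + (i \in sched t).

(** Activating idle agents changes nothing, so the adversary can only delay [i], free of charge,
    until fairness activates it. *)
Lemma reach_single i c : (forall i', i' != i -> idle c i') ->
  reach c (step agents [set i] c) 1.
Proof.
move=> Hidle t Ht; have [t' [tt' it']] := sched_fair i t.
rewrite -(subnKC tt') in it'; move: (t' - t) it' => d {t' tt'}.
have next t1 : ceq (run agents init sched t1) c ->
    ceq (run agents init sched t1.+1) (if i \in sched t1 then step agents [set i] c else c).
  move=> H1; apply: ceq_trans (step_ceq _ H1) _.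
  case: ifP => it; split=> i' /=; rewrite ?inE; have [->|ni] := eqVneq i' i; rewrite ?it //;
    by case: ifP => // _; rewrite (Hidle _ ni).
elim: d t Ht => [|d IH] t Ht it.
  exists t.+1; last by apply: leq_trans (clk_idle Ht Hidle) _; rewrite leq_add2l leq_b1.
  by rewrite addn0 in it; have := next t Ht; rewrite it.
have := next t Ht; have := clk_idle Ht Hidle.
case: ifP => it0 Hc Hn; first by exists t.+1.
have [|t' Ht' Hc'] := IH t.+1 Hn; first by rewrite addSnnS.
by exists t' => //; lia.
Qed.

Lemma conf_pos q L P ph i : (conf q L P ph).1 i = if role i is Some j then get P j else L.
Proof. by []. Qed.

Lemma conf_state q L P ph i : (conf q L P ph).2 i =
  if role i is Some j then inr (j, if j == Work then ph else None) else inl q.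
Proof. by []. Qed.

Definition sees L (P : places (cell n)) j := present j && (get P j == L).

Lemma agents_leader q L P ph i : role i = None ->
  agents (inl q) (observe (conf q L P ph) i) =
    match program q with
    | Test j a b => let a' := if sees L P j then a else b in (inl a'.1, a'.2)
    | Push j _ a => if sees L P j then (inl q, None) else (inl a.1, a.2)
    | Launch a => (inl a.1, a.2)
    end.
Proof.
move=> Hi; rewrite /agents; case: (program q) => [j a b|j m a|a] //.
- by rewrite observe_pebble conf_pos Hi; case: ifP => _; [case: a|case: b].
- by rewrite observe_pebble conf_pos Hi.
Qed.

Lemma agents_pebble q L P ph i j : role i = Some j ->
  agents (inr (j, None)) (observe (conf q L P ph) i) =
    if L == get P j then
      match program q with
      | Push j' m _ => (inr (j, None), if j' == j then Some m else None)
      | Launch _ => (inr (j, if j == Work then Some true else None), None)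
      | _ => (inr (j, None), None)
      end
    else (inr (j, None), None).
Proof.
move=> Hi; rewrite /agents pick_leader conf_pos Hi; case: ifP => // _ /=.
by case: (program q) => // j' m _; case: eqP.
Qed.

Lemma reach_leader q L P q' m :
  (forall i, role i = None -> agents (inl q) (observe (conf q L P None) i) = (inl q', m)) ->
  (forall i j, role i = Some j ->
     agents (inr (j, None)) (observe (conf q L P None) i) = (inr (j, None), None)) ->
  reach (conf q L P None) (conf q' (shift L m) P None) 1.
Proof.
move=> HL HP; have [i Hi] := role_leader.
apply: (@reach_ceq _ (step agents [set i] (conf q L P None))).
  split=> i' /=; rewrite inE; have [->|ni] := eqVneq i' i; rewrite ?Hi ?HL //;
    case E: (role i') => [j|] //; by case/eqP: ni; apply: role_inj; rewrite Hi.
apply: reach_single => i' ni; rewrite /idle conf_state.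
case E: (role i') => [j|]; first by rewrite if_same HP.
by case/eqP: ni; apply: role_inj; rewrite Hi.
Qed.

Lemma reach_test q L P j a b : program q = Test j a b ->
  let a' := if sees L P j then a else b in
  reach (conf q L P None) (conf a'.1 (shift L a'.2) P None) 1.
Proof.
move=> Hq a'; apply: reach_leader => [i Hi|i j' Hi].
  by rewrite agents_leader // Hq.
by rewrite agents_pebble // Hq if_same.
Qed.

(** Two forced single steps: the leader waits while it sees the pebble, and once the pebble has left
    it no longer hears the order. *)
Lemma reach_push q L P j m a m' :
  program q = Push j m (a, m') -> present j -> get P j = L ->
  reach (conf q L P None) (conf a (shift L m') (put P j (shift L (Some m))) None) 2.
Proof.
move=> Hq pj PL; set P' := put _ _ _.
have P'j : get P' j = shift L (Some m) by rewrite get_put eqxx.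
apply: (@reach_trans (conf q L P' None) _ _ 1 1) => //; last first.
  have ns : sees L P' j = false by rewrite /sees P'j (negbTE (shift_neq _ _)) andbF.
  apply: reach_leader => [i Hi|i j' Hi]; first by rewrite agents_leader // Hq ns.
  rewrite agents_pebble // Hq; case: eqP => // LP'; case: eqP LP' => // <- /esym/eqP.
  by rewrite P'j (negbTE (shift_neq _ _)).
have [i Hi] := role_onto pj.
apply: (@reach_ceq _ (step agents [set i] (conf q L P None))).
  split=> i' /=; rewrite inE; have [->|ni] := eqVneq i' i; rewrite ?Hi ?if_same //.
  - by rewrite agents_pebble // Hq PL !eqxx.
  - case E: (role i') => [j'|] //; rewrite get_put; case: eqP => // jj.
    by case/eqP: ni; apply: role_inj; rewrite Hi E jj.
  - by rewrite agents_pebble // Hq PL !eqxx.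
apply: reach_single => i' ni; rewrite /idle conf_state.
case E: (role i') => [j'|].
  rewrite if_same agents_pebble // Hq; case: eqP => // _; case: eqP => // jj.
  by case/eqP: ni; apply: role_inj; rewrite Hi E jj.
by rewrite agents_leader // Hq /sees pj PL eqxx.
Qed.

Lemma reach_yes q L P j a m b : program q = Test j (a, m) b -> sees L P j ->
  reach (conf q L P None) (conf a (shift L m) P None) 1.
Proof. by move=> Hq Hs; have := @reach_test q L P j _ _ Hq; rewrite Hs. Qed.

Lemma reach_no q L P j a b m : program q = Test j a (b, m) -> sees L P j = false ->
  reach (conf q L P None) (conf b (shift L m) P None) 1.
Proof. by move=> Hq Hs; have := @reach_test q L P j _ _ Hq; rewrite Hs. Qed.

Lemma seek_forth q (p : cell n) l t P j a :
  program q = Test j (a, None) (q, Some forth) -> present j ->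
  get P j = along i0 p t -> l <= t ->
  reach (conf q (along i0 p l) P None) (conf a (along i0 p t) P None) (t - l).+1.
Proof.
move=> Hq pj Pj lt; move: (t - l) (subnKC lt) => d E; elim: d l {lt} E => [|d IH] l E.
  rewrite -E addn0 in Pj *; apply: (reach_yes Hq).
  by rewrite /sees pj Pj eqxx.
apply: (@reach_trans (conf q (along i0 p l.+1) P None) _ _ 1 d.+1) => //; last by apply: IH; lia.
rewrite -along_forth; apply: (reach_no Hq).
by rewrite /sees Pj along_eq; case: eqP; rewrite ?andbF //; lia.
Qed.

Lemma seek_back q (p : cell n) l t P j a :
  program q = Test j (a, None) (q, Some back) -> present j ->
  get P j = along i0 p t -> t <= l ->
  reach (conf q (along i0 p l) P None) (conf a (along i0 p t) P None) (l - t).+1.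
Proof.
move=> Hq pj Pj tl; move: (l - t) (subnKC tl) => d E; elim: d l {tl} E => [|d IH] l E.
  rewrite -E addn0 in Pj *; apply: (reach_yes Hq).
  by rewrite /sees pj Pj eqxx.
case: l E => [|l] E; first by lia.
apply: (@reach_trans (conf q (along i0 p l) P None) _ _ 1 d.+1) => //; last by apply: IH; lia.
rewrite -(along_back _ p l); apply: (reach_no Hq).
by rewrite /sees Pj along_eq; case: eqP; rewrite ?andbF //; lia.
Qed.

(** * Searching and carrying along the line *)

Definition spread (p : cell n) (P : places nat) : places (cell n) :=
  let: (s, b, w, r) := P in (along i0 p s, along i0 p b, along i0 p w, along i0 p r).

Lemma get_spread p P j : get (spread p P) j = along i0 p (get P j).
Proof. by move: P => [[[s b] w] r]; case: j. Qed.

Lemma put_spread p P j x : put (spread p P) j (along i0 p x) = spread p (put P j x).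
Proof. by move: P => [[[s b] w] r]; case: j. Qed.

Definition line q p l P := conf q (along i0 p l) (spread p P) None.

Lemma sees_spread p l P j : sees (along i0 p l) (spread p P) j = present j && (get P j == l).
Proof. by rewrite /sees get_spread along_eq. Qed.

Lemma line_yes q p l P j a b : program q = Test j (a, None) b -> present j ->
  get P j = l -> reach (line q p l P) (line a p l P) 1.
Proof. by move=> Hq pj Pl; apply: (reach_yes Hq); rewrite sees_spread pj Pl eqxx. Qed.

Lemma line_no q p l P j a b : program q = Test j a (b, None) ->
  get P j != l -> reach (line q p l P) (line b p l P) 1.
Proof. by move=> Hq Pl; apply: (reach_no Hq); rewrite sees_spread (negbTE Pl) andbF. Qed.

Lemma line_push_forth q p l P j a m : program q = Push j forth (a, m) -> present j ->
  get P j = l ->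
  reach (line q p l P)
    (conf a (shift (along i0 p l) m) (spread p (put P j l.+1)) None) 2.
Proof.
move=> Hq pj Pl; have := reach_push Hq pj (L := along i0 p l) (P := spread p P).
by rewrite along_forth put_spread; apply; rewrite get_spread Pl.
Qed.

Lemma line_push_back q p l P j a m : program q = Push j back (a, m) -> present j ->
  get P j = l.+1 ->
  reach (line q p l.+1 P)
    (conf a (shift (along i0 p l.+1) m) (spread p (put P j l)) None) 2.
Proof.
move=> Hq pj Pl; have := reach_push Hq pj (L := along i0 p l.+1) (P := spread p P).
by rewrite along_back put_spread; apply; rewrite get_spread Pl.
Qed.

(** Each cell costs 3: a test, the pebble's move and the leader's move; the final test adds 1. *)
Lemma carry_forth q q' p l P j j' a :
  program q = Test j' (a, None) (q', None) -> program q' = Push j forth (q, Some forth) ->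
  present j -> present j' -> j' != j -> get P j = l -> l <= get P j' ->
  reach (line q p l P) (line a p (get P j') (put P j (get P j'))) (3 * (get P j' - l)).+1.
Proof.
move=> Hq Hq' pj pj' jj; move Et: (get P j') => t + lt.
move: (t - l) (subnKC lt) => d E; elim: d l P {lt} E Et => [|d IH] l P E Et Pl.
  have Etl : t = l by rewrite -E addn0.
  have <- : P = put P j t by rewrite Etl -Pl put_get.
  by rewrite Etl; apply: (line_yes Hq) => //; rewrite Et.
apply: (@reach_trans (line q' p l P) _ _ 1 (3 * d + 3)); last by lia.
  by apply: (line_no Hq); rewrite Et; apply/eqP; lia.
apply: (@reach_trans (line q p l.+1 (put P j l.+1)) _ _ 2 (3 * d).+1); last by lia.
  by rewrite /line -along_forth; apply: line_push_forth.
rewrite -(put_put P j l.+1 t); apply: IH; rewrite ?get_put ?eqxx ?(negbTE jj) //; lia.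
Qed.

Lemma carry_back q q' p l P j j' a :
  program q = Test j' (a, None) (q', None) -> program q' = Push j back (q, Some back) ->
  present j -> present j' -> j' != j -> get P j = l -> get P j' <= l ->
  reach (line q p l P) (line a p (get P j') (put P j (get P j'))) (3 * (l - get P j')).+1.
Proof.
move=> Hq Hq' pj pj' jj; move Et: (get P j') => t + tl.
move: (l - t) (subnKC tl) => d E; elim: d l P {tl} E Et => [|d IH] l P E Et Pl.
  have Etl : t = l by rewrite -E addn0.
  have <- : P = put P j t by rewrite Etl -Pl put_get.
  by rewrite Etl; apply: (line_yes Hq) => //; rewrite Et.
case: l E Pl => [|l] E Pl; first by lia.
apply: (@reach_trans (line q' p l.+1 P) _ _ 1 (3 * d + 3)); last by lia.
  by apply: (line_no Hq); rewrite Et; apply/eqP; lia.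
apply: (@reach_trans (line q p l (put P j l)) _ _ 2 (3 * d).+1); last by lia.
  by rewrite /line -(along_back _ p l); apply: line_push_back.
rewrite -(put_put P j l t); apply: IH; rewrite ?get_put ?eqxx ?(negbTE jj) //; lia.
Qed.

Lemma line_seek_forth q p l P j a t : program q = Test j (a, None) (q, Some forth) ->
  present j -> get P j = t -> l <= t -> reach (line q p l P) (line a p t P) (t - l).+1.
Proof. by move=> Hq pj Pj lt; apply: (seek_forth Hq pj) => //; rewrite get_spread Pj. Qed.

Lemma line_seek_back q p l P j a t : program q = Test j (a, None) (q, Some back) ->
  present j -> get P j = t -> t <= l -> reach (line q p l P) (line a p t P) (l - t).+1.
Proof. by move=> Hq pj Pj lt; apply: (seek_back Hq pj) => //; rewrite get_spread Pj. Qed.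

Lemma divide_all p s u : 0 < u ->
  (forall f w, 0 < w <= s ->
     reach (line (at_label Divide f) p w (s, 0, w, 0))
       (line (at_label Divide (fs f (inord (w %% 3)))) p (w %/ 3) (s, 0, w %/ 3, 0)) (u * w)) ->
  forall f w, w <= s ->
     reach (line (at_label Divide f) p w (s, 0, w, 0))
       (line (at_label ShiftBase (digits fs f w)) p 0 (s, 0, 0, 0)) (2 * (u * w)).+1.
Proof.
move=> u0 Hdiv f w; elim/ltn_ind: w f => w IH f ws.
case: (posnP w) => [->|w0].
  by apply: (@reach_le _ _ 1) => //; apply: line_yes.
have ws' : 0 < w <= s by rewrite w0.
rewrite digitsE //; apply: (reach_trans (Hdiv f w ws')).
  by apply: IH; lia.
(* Dividends shrink by a factor 3, so u w + 2 u (w / 3) stays below 2 u w. *)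
have : u * (3 * (w %/ 3)) <= u * w by rewrite leq_mul2l; lia.
by rewrite mulnCA; lia.
Qed.

Lemma count p g s :
  reach (line (at_label Count g) p s (s, 0, 0, 0))
    (line (at_label Fetch f0) p 0 (s.+1, 0, 0, 0)) (s + 3).
Proof.
apply: (@reach_trans (line (at_label Return g) p s (s.+1, 0, 0, 0)) _ _ 2 s.+1); last by lia.
  exact: (@line_push_forth (at_label Count g) p s (s, 0, 0, 0) Mark _ None).
by have := @line_seek_back (at_label Return g) p s (s.+1, 0, 0, 0) Base _ 0 erefl;
  rewrite subn0; apply.
Qed.

Lemma conf_aux q L s b w r r' : sy ->
  ceq (conf q L (s, b, w, r) None) (conf q L (s, b, w, r') None).
Proof.
move=> sync; split=> i; rewrite ?conf_state // !conf_pos.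
by case E: (role i) => [[]|] //; have := role_present E; rewrite /present sync.
Qed.

Lemma move_group p g s :
  reach (line (at_label ShiftBase g) p 0 (s, 0, 0, 0))
    (line (at_label Count g) (shift p (out g)) s (s, 0, 0, 0)) (s + 9).
Proof.
case Eo: (out g) => [m|]; last first.
  apply: (@reach_trans (line (at_label ToMark g) p 0 (s, 0, 0, 0)) _ _ 1 s.+1); last by lia.
    by apply: (@line_yes (at_label ShiftBase g) p 0 _ Base _ (at_label ToMark g, None)); rewrite /= ?Eo.
  have := @line_seek_forth (at_label ToMark g) p 0 (s, 0, 0, 0) Mark (at_label Count g) s.
  by rewrite subn0; apply; rewrite //= ?Eo.
set p' := shift p (Some m).
have S k : shift (along i0 p k) (Some m) = along i0 p' k by rewrite /p' along_shift.
pose A := along i0 p; pose B := along i0 p'.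
(* Synchronously the dummy place of [Aux] is left behind; [conf_aux] corrects it at the end. *)
pose r := if sy then A 0 else B 0.
have P1 : program (at_label ShiftBase g) = Push Base m (at_label ShiftWork g, None).
  by rewrite /= Eo.
have P2 : program (at_label ShiftWork g) =
    Push Work m (at_label (if sy then ToMark else ShiftAux) g, None) by rewrite /= Eo.
have P3 : program (at_label ShiftAux g) = Push Aux m (at_label ToMark g, None).
  by rewrite /= Eo.
have P4 : program (at_label ToMark g) =
    Test Mark (at_label ShiftMark g, None) (at_label ToMark g, Some forth) by rewrite /= Eo.
have P5 : program (at_label ShiftMark g) = Push Mark m (at_label Count g, Some m).
  by rewrite /= Eo.
apply: (@reach_trans (conf (at_label ShiftWork g) (A 0) (A s, B 0, A 0, A 0) None) _ _ 2 (s + 7));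
  last by lia.
  by rewrite /B -S; apply: (@reach_push _ (A 0) (A s, A 0, A 0, A 0) Base m _ None P1).
apply: (@reach_trans (conf (at_label ToMark g) (A 0) (A s, B 0, B 0, r) None) _ _ 4 (s + 3));
  last by lia.
  apply: (@reach_trans (conf (at_label (if sy then ToMark else ShiftAux) g) (A 0)
    (A s, B 0, B 0, A 0) None) _ _ 2 2) => //.
    have := @reach_push _ (A 0) (A s, B 0, A 0, A 0) Work m _ None P2.
    by rewrite S; apply.
  rewrite /r; case: ifP => sync; first exact: reach_le (@reach_refl _) _.
  have := @reach_push _ (A 0) (A s, B 0, B 0, A 0) Aux m _ None P3.
  by rewrite S /present sync; apply.
apply: (@reach_trans (conf (at_label ShiftMark g) (A s) (A s, B 0, B 0, r) None) _ _ s.+1 2);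
  last by lia.
  by have := @seek_forth _ p 0 s (A s, B 0, B 0, r) Mark _ P4; rewrite subn0; apply.
apply: (@reach_ceq _ (conf (at_label Count g) (B s) (B s, B 0, B 0, r) None)).
  by rewrite /r; case: ifP => // sync; exact: conf_aux.
have := @reach_push _ (A s) (A s, B 0, B 0, r) Mark m _ (Some m) P5.
by rewrite S; apply.
Qed.

(** The parameter [u] is the price of division per unit of [w]: a constant synchronously,
    proportional to s otherwise. The phases sum to 2us + 5s + 14, which is at most 21us. *)
Lemma one_round p s u : 0 < u ->
  (forall f w, 0 < w <= s ->
     reach (line (at_label Divide f) p w (s, 0, w, 0))
       (line (at_label Divide (fs f (inord (w %% 3)))) p (w %/ 3) (s, 0, w %/ 3, 0)) (u * w)) ->
  0 < s ->
  reach (line (at_label Fetch f0) p 0 (s, 0, 0, 0))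
    (line (at_label Fetch f0) (shift p (out (digits fs f0 s))) 0 (s.+1, 0, 0, 0)) (21 * (u * s)).
Proof.
move=> u0 Hdiv s0; set g := digits fs f0 s.
have us : s <= u * s by rewrite leq_pmull.
apply: (@reach_trans (line (at_label Divide f0) p s (s, 0, s, 0)) _ _ (3 * s).+1 (2 * (u * s) + 2 * s + 13));
  last by lia.
  have := @carry_forth (at_label Fetch f0) (at_label FetchStep f0) p 0 (s, 0, 0, 0) Work Mark _ erefl erefl.
  by rewrite subn0; apply.
apply: (@reach_trans (line (at_label ShiftBase g) p 0 (s, 0, 0, 0)) _ _ (2 * (u * s)).+1 (2 * s + 12));
  last by lia.
  exact: divide_all.
apply: (@reach_trans (line (at_label Count g) (shift p (out g)) s (s, 0, 0, 0)) _ _ (s + 9) (s + 3));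
  last by lia.
  exact: move_group.
exact: count.
Qed.

(** Rounds need a positive counter, so the run begins in [Count] with counter 0, for 3 units. Then t
    rounds follow, each with a counter at most t. *)
Lemma many_rounds K d t :
  (forall s p, 0 < s -> reach (line (at_label Fetch f0) p 0 (s, 0, 0, 0))
    (line (at_label Fetch f0) (shift p (out (digits fs f0 s))) 0 (s.+1, 0, 0, 0)) (K * s ^ d)) ->
  reach (line (at_label Count f0) (origin n) 0 (0, 0, 0, 0))
    (line (at_label Fetch f0) (walk fs out f0 t) 0 (t.+1, 0, 0, 0)) (3 + K * t ^ d.+1).
Proof.
move=> H; elim: t => [|t IH].
  by apply: (@reach_le _ _ (0 + 3)); [exact: count | rewrite add0n leq_addr].
apply: (@reach_trans (line (at_label Fetch f0) (walk fs out f0 t) 0 (t.+1, 0, 0, 0)) _ _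
  (3 + K * t ^ d.+1) (K * t.+1 ^ d)) => //; first exact: H.
rewrite -addnA leq_add2l -mulnDr leq_mul2l; apply/orP; right.
rewrite [t.+1 ^ d.+1]expnS mulSn addnC leq_add2l expnS leq_mul2l.
by case: d {H IH} => [|d]; rewrite ?expn0 ?orbT // leq_exp2r // leqnSn orbT.
Qed.

(** * Division by 3 *)

Section SemiSync.
Hypothesis semi : sy = false.

Lemma present_semi j : present j.
Proof. by rewrite /present semi implybT. Qed.
Hint Resolve present_semi : core.

Lemma strip_one f p s l r k : k < 3 ->
  reach (line (Strip, f, inord k) p l.+1 (s, 0, l.+1, r))
    (line (if k == 2 then at_label ToBase f else (Strip, f, inord k.+1)) p l (s, 0, l, r)) 3.
Proof.
move=> k3; apply: (@reach_trans (line (StripStep, f, inord k) p l.+1 (s, 0, l.+1, r)) _ _ 1 2) => //.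
  exact: line_no.
rewrite /line -(along_back _ p l); apply: (line_push_back (j := Work) (P := (s, 0, l.+1, r))) => //.
by rewrite /= inordK.
Qed.

(** Three cells off [Work] become one cell on [Aux]. The leader passes through [Base] both ways, so
    it need not know which of the two pebbles is nearer. *)
Lemma strip_three f p s w r : w + 3 <= s -> r <= s ->
  reach (line (at_label Strip f) p (w + 3) (s, 0, w + 3, r))
    (line (at_label Strip f) p w (s, 0, w, r.+1)) (9 * s).
Proof.
move=> ws rs; have -> : at_label Strip f = (Strip, f, inord 0).
  by congr (_, _, _); apply: val_inj; rewrite /= inordK.
rewrite addn3.
apply: (@reach_trans (line (Strip, f, inord 1) p w.+2 (s, 0, w.+2, r)) _ _ 3 (4 * s + 12)).
- exact: (@strip_one f p s w.+2 r 0).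
apply: (@reach_trans (line (Strip, f, inord 2) p w.+1 (s, 0, w.+1, r)) _ _ 3 (4 * s + 9)).
- exact: (@strip_one f p s w.+1 r 1).
apply: (@reach_trans (line (at_label ToBase f) p w (s, 0, w, r)) _ _ 3 (4 * s + 6)).
- exact: (@strip_one f p s w r 2).
apply: (@reach_trans (line (at_label ToAux f) p 0 (s, 0, w, r)) _ _ w.+1 (2 * r + w + 5));
  last by lia.
  by have := @line_seek_back (at_label ToBase f) p w (s, 0, w, r) Base _ 0 erefl;
    rewrite subn0; apply.
apply: (@reach_trans (line (at_label Bump f) p r (s, 0, w, r)) _ _ r.+1 (r + w + 4)); last by lia.
  by have := @line_seek_forth (at_label ToAux f) p 0 (s, 0, w, r) Aux _ r erefl;
    rewrite subn0; apply.
apply: (@reach_trans (line (at_label BackBase f) p r (s, 0, w, r.+1)) _ _ 2 (r + w + 2));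
  last by lia.
  exact: (@line_push_forth (at_label Bump f) p r (s, 0, w, r) Aux _ None).
apply: (@reach_trans (line (at_label BackWork f) p 0 (s, 0, w, r.+1)) _ _ r.+1 w.+1); last by lia.
  by have := @line_seek_back (at_label BackBase f) p r (s, 0, w, r.+1) Base _ 0 erefl;
    rewrite subn0; apply.
have <- : at_label Strip f = (Strip, f, inord 0).
  by congr (_, _, _); apply: val_inj; rewrite /= inordK.
by have := @line_seek_forth (at_label BackWork f) p 0 (s, 0, w, r.+1) Work _ w erefl;
  rewrite subn0; apply.
all: lia.
Qed.

Lemma strip_all f p s q e r : e < 3 -> 3 * q + e <= s -> r + q <= s ->
  reach (line (at_label Strip f) p (3 * q + e) (s, 0, 3 * q + e, r))
    (line (at_label Meet (fs f (inord e))) p 0 (s, 0, 0, r + q)) (9 * s * q + 7).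
Proof.
move=> e3; elim: q r => [|q IH] r ws rs.
  rewrite muln0 add0n addn0.
  (* With k cells left before [Base], e - k have been counted since the last multiple of 3. *)
  suff H k : k <= e -> reach (line (Strip, f, inord (e - k)) p k (s, 0, k, r))
      (line (at_label Meet (fs f (inord e))) p 0 (s, 0, 0, r)) (3 * k + 1).
    have := H e (leqnn e); rewrite subnn.
    have -> : (Strip, f, inord 0) = at_label Strip f.
      by congr (_, _, _); apply: val_inj; rewrite /= inordK.
    by move=> He; apply: reach_le He _; lia.
  elim: k => [|k IHk] ke; first by rewrite subn0; apply: line_yes.
  have ek : e - k.+1 < 3 by lia.
  apply: (@reach_trans (line (Strip, f, inord (e - k)) p k (s, 0, k, r)) _ _ 3 (3 * k + 1));
    last by lia.
    have := @strip_one f p s k r (e - k.+1) ek.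
    have -> : (e - k.+1 == 2) = false by apply/eqP; lia.
    by have -> : (e - k.+1).+1 = e - k by lia.
  by apply: IHk; lia.
have E : 3 * q.+1 + e = (3 * q + e) + 3 by lia.
rewrite E -(addSnnS r q); apply: (@reach_trans _ _ _ (9 * s) (9 * s * q + 7)).
- by apply: strip_three; lia.
- by apply: IH; lia.
- by rewrite mulnS; lia.
Qed.

Lemma divide_semi f p s w : 0 < w <= s ->
  reach (line (at_label Divide f) p w (s, 0, w, 0))
    (line (at_label Divide (fs f (inord (w %% 3)))) p (w %/ 3) (s, 0, w %/ 3, 0)) (17 * s * w).
Proof.
case/andP => w0 ws; set q := w %/ 3; set g := fs f _.
have wE : w = 3 * q + w %% 3 by rewrite mulnC -divn_eq.
have e3 : w %% 3 < 3 by rewrite ltn_mod.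
have cost : 9 * s * q + 7 * q + 11 <= 17 * s * w.
  have ? : s * (3 * q) <= s * w by rewrite leq_mul2l; lia.
  have ? : w <= s * w by rewrite leq_pmull //; lia.
  by rewrite -!mulnA mulnCA; lia.
apply: (@reach_trans (line (at_label Strip f) p w (s, 0, w, 0)) _ _ 1 (9 * s * q + 7 * q + 10));
  last by lia.
  apply: line_no; first by rewrite /= semi.
  by rewrite /= eq_sym -lt0n.
apply: (@reach_trans (line (at_label Meet g) p 0 (s, 0, 0, q)) _ _ (9 * s * q + 7) (7 * q + 3));
  last by lia.
  by rewrite {1 2}wE -[q in X in reach _ X]add0n; apply: strip_all; lia.
apply: (@reach_trans (line (at_label Drop g) p q (s, 0, q, q)) _ _ (3 * q).+1 (4 * q + 2));
  last by lia.
  have := @carry_forth (at_label Meet g) (at_label MeetStep g) p 0 (s, 0, 0, q) Work Aux _ erefl erefl.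
  by rewrite subn0; apply.
apply: (@reach_trans (line (at_label Rejoin g) p 0 (s, 0, q, 0)) _ _ (3 * q).+1 q.+1); last by lia.
  have := @carry_back (at_label Drop g) (at_label DropStep g) p q (s, 0, q, q) Aux Base _ erefl erefl.
  by rewrite subn0; apply.
by have := @line_seek_forth (at_label Rejoin g) p 0 (s, 0, q, 0) Work _ q erefl;
  rewrite subn0; apply.
Qed.

End SemiSync.

(** * Synchronous division by slow walking *)

Section Sync.
Hypothesis all_active : forall t, sched t = [set: 'I_team].
Hypothesis clkS : forall t, clk t.+1 = (clk t).+1.

Lemma step_all_pos (c : config n astate team) i :
  (step agents [set: 'I_team] c).1 i = shift (c.1 i) (agents (c.2 i) (observe c i)).2.
Proof. by rewrite /step /= inE. Qed.

Lemma step_all_state (c : config n astate team) i :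
  (step agents [set: 'I_team] c).2 i = (agents (c.2 i) (observe c i)).1.
Proof. by rewrite /step /= inE. Qed.

Lemma reach_all c : reach c (step agents [set: 'I_team] c) 1.
Proof.
move=> t Ht; exists t.+1; last by rewrite clkS addn1.
by rewrite /= all_active; exact: step_ceq.
Qed.

Lemma reach_launch q L P a m : program q = Launch (a, m) -> get P Work = L ->
  reach (conf q L P None) (conf a (shift L m) P (Some true)) 1.
Proof.
move=> Hq PL; apply: (@reach_ceq _ _ _ _ _ (@reach_all _)).
set c := conf q L P None.
have HL i : role i = None -> agents (c.2 i) (observe c i) = (inl a, m).
  by move=> Hi; rewrite conf_state Hi agents_leader // Hq.
have HP i j : role i = Some j -> agents (c.2 i) (observe c i) =
    (inr (j, if j == Work then Some true else None), None).
  move=> Hi; rewrite conf_state Hi if_same agents_pebble // Hq.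
  by case: (j =P Work) => [->|_]; rewrite ?if_same // PL eqxx.
split=> i; rewrite ?step_all_pos ?step_all_state; case E: (role i) => [j|].
- by rewrite (HP _ _ E) !conf_pos E.
- by rewrite HL // !conf_pos E.
- by rewrite (HP _ _ E) conf_state E.
- by rewrite HL // conf_state E.
Qed.

(* [u] is the time since [Work] left the place [z]. *)
Definition slow (q : control) (p : cell n) (l s z u : nat) :=
  conf q (along i0 p l) (spread p (s, 0, z - uphalf u, 0)) (Some (~~ odd u)).

Lemma agents_slow q L P ph i : role i = Some Work ->
  agents (inr (Work, Some true)) (observe (conf q L P ph) i) =
    if (L == get P Work) && (if program q is Test Work _ _ then true else false)
    then (inr (Work, None), None) else (inr (Work, Some false), Some back).
Proof.
move=> Hi; rewrite /agents pick_leader conf_pos Hi; case: ifP => // _ /=.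
by case: (program q) => [[]| |].
Qed.

(** The side conditions keep [Work] from passing [Base], so the truncated subtraction is exact, and
    from being stopped by a leader testing for it in its cell. *)
Lemma reach_slow q p l s z u j a b : program q = Test j a b ->
  uphalf u.+1 <= z -> (j = Work -> z - uphalf u <> l) ->
  let a' := if present j && (get (s, 0, z - uphalf u, 0) j == l) then a else b in
  reach (slow q p l s z u)
    (conf a'.1 (shift (along i0 p l) a'.2) (spread p (s, 0, z - uphalf u.+1, 0))
       (Some (~~ odd u.+1))) 1.
Proof.
move=> Hq uz Hj; cbv zeta; rewrite -(sees_spread p l (s, 0, z - uphalf u, 0) j); apply: (@reach_ceq _ _ _ _ _ (@reach_all _)).
set c := slow q p l s z u.
have HL i : role i = None -> agents (c.2 i) (observe c i) =
    let a' := if sees (along i0 p l) (spread p (s, 0, z - uphalf u, 0)) j then a else b in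
    (inl a'.1, a'.2).
  by move=> Hi; rewrite conf_state Hi agents_leader // Hq.
have HP i j' : role i = Some j' -> j' <> Work ->
    agents (c.2 i) (observe c i) = (inr (j', None), None).
  move=> Hi /eqP/negbTE jW; rewrite conf_state Hi jW agents_pebble // Hq.
  by rewrite if_same.
have HW i : role i = Some Work -> agents (c.2 i) (observe c i) =
    if odd u then (inr (Work, Some true), None) else (inr (Work, Some false), Some back).
  move=> Hi; rewrite conf_state Hi eqxx; case: (odd u) => //=.
  rewrite agents_slow // Hq [get _ _]/= along_eq.
  by case: j Hj {Hq HL} => //= Hj; rewrite ?andbF //; case: eqP => // E; case: Hj.
have Hu : z - uphalf u.+1 = if odd u then z - uphalf u else (z - uphalf u).-1.
  by rewrite /= uphalf_half; case: (odd u); lia.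
have Hz : ~~ odd u -> z - uphalf u = (z - uphalf u).-1.+1.
  by move: uz; rewrite /= uphalf_half; case: (odd u) => //=; lia.
split=> i; rewrite ?step_all_pos ?step_all_state; case E: (role i) => [j'|].
- case: (j' =P Work) => jW; last by rewrite (HP _ _ E jW) !conf_pos E; case: (j') jW.
  rewrite HW ?E ?jW // !conf_pos E jW [get _ _]/= [get _ _]/= Hu.
  case: (odd u) Hz => //= /(_ isT) {1}->.
  by rewrite along_back.
- by rewrite HL // !conf_pos E.
- rewrite conf_state E; case: (j' =P Work) => jW; last by rewrite (HP _ _ E jW).
  by rewrite HW ?E ?jW //=; case: (odd u).
- by rewrite HL // conf_state E.
Qed.

(** Both agents look at the same configuration: the leader sees [Work] in the very step in which
    [Work] sees the test and halts. *)
Lemma reach_catch q L P a b : program q = Test Work (a, None) b -> get P Work = L ->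
  reach (conf q L P (Some true)) (conf a L P None) 1.
Proof.
move=> Hq PL; apply: (@reach_ceq _ _ _ _ _ (@reach_all _)).
set c := conf q L P (Some true).
have HL i : role i = None -> agents (c.2 i) (observe c i) = (inl a, None).
  by move=> Hi; rewrite conf_state Hi agents_leader // Hq /sees PL eqxx.
have HP i j : role i = Some j -> agents (c.2 i) (observe c i) = (inr (j, None), None).
  move=> Hi; rewrite conf_state Hi; case: (j =P Work) Hi => [->|_] Hi.
    by rewrite agents_slow // PL eqxx Hq.
  by rewrite agents_pebble // Hq if_same.
split=> i; rewrite ?step_all_pos ?step_all_state; case E: (role i) => [j|].
- by rewrite (HP _ _ E) !conf_pos E.
- by rewrite HL // !conf_pos E.
- by rewrite (HP _ _ E) conf_state E if_same.
- by rewrite HL // conf_state E.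
Qed.

Lemma slow_step q q' p l l' s z u j a b m : program q = Test j a b ->
  uphalf u.+1 <= z -> (j = Work -> z - uphalf u <> l) ->
  (if present j && (get (s, 0, z - uphalf u, 0) j == l) then a else b) = (q', m) ->
  shift (along i0 p l) m = along i0 p l' ->
  reach (slow q p l s z u) (slow q' p l' s z u.+1) 1.
Proof.
move=> Hq uz Hj Ha Hl; have := @reach_slow q p l s z u j a b Hq uz Hj.
by rewrite Ha /= Hl.
Qed.

(** At time u the leader has walked u + 1 cells, the first during the launch. Hence it carries w mod
    3 at [Base], and the test there completes time w. *)
Lemma inward f p s w l u : u + l.+1 = w ->
  reach (slow (Inward, f, inord (u.+1 %% 3)) p l s w u)
    (slow (Await, fs f (inord (w %% 3)), inord (w %% 3)) p 0 s w w) l.+1.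
Proof.
elim: l u => [|l IH] u E.
  rewrite -E addn1; apply: (slow_step (m := None) (j := Base)
    (a := ((Await, fs f (inord (u.+1 %% 3)), inord (u.+1 %% 3)), None))
    (b := ((Inward, f, inord ((inord (u.+1 %% 3) : 'I_3).+1 %% 3)), Some back))) => //.
  by rewrite uphalf_half; lia.
apply: (@reach_trans (slow (Inward, f, inord (u.+2 %% 3)) p l s w u.+1) _ _ 1 l.+1) => //.
  apply: (slow_step (m := Some back) (j := Base)
    (a := ((Await, fs f (inord (u.+1 %% 3)), inord (u.+1 %% 3)), None))
    (b := ((Inward, f, inord ((inord (u.+1 %% 3) : 'I_3).+1 %% 3)), Some back))) => //.
  - by rewrite uphalf_half; lia.
  - rewrite /= inordK ?ltn_mod //; congr (Inward, f, inord _, Some back).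
    by rewrite -[(_ %% _).+1]addn1 modnDml addn1.
  - exact: along_back.
by apply: IH; lia.
Qed.

Lemma await g p s w u r : r < 3 -> uphalf (u + r) <= w ->
  reach (slow (Await, g, inord r) p 0 s w u) (slow (Await, g, inord 0) p 0 s w (u + r)) r.
Proof.
elim: r u => [|r IH] u r3 uw; first by rewrite addn0; apply: reach_refl.
apply: (@reach_trans (slow (Await, g, inord r) p 0 s w u.+1) _ _ 1 r) => //.
  apply: (slow_step (m := None) (j := Base)
    (a := (Await, g, inord r, None)) (b := (Await, g, inord r, None))) => //.
  - by rewrite /= inordK.
  - by apply: leq_trans uw; apply: uphalf_leq; lia.
by rewrite -addSnnS; apply: IH; rewrite ?addSnnS //; lia.
Qed.

(** At time w + e + y the leader is at y. For y = q this time is 4q + 2e: [Work] has made 2q + e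
    moves and stands at q, and the time is even, so it is in the phase in which it can be caught. *)
Lemma catch_up g p s q e y : e < 3 -> 0 < 3 * q + e -> y <= q ->
  reach (slow (Await, g, inord 0) p y s (3 * q + e) (3 * q + e + e + y))
    (line (at_label Divide g) p q (s, 0, q, 0)) (q - y).+1.
Proof.
move=> e3 w0 yq; set w := 3 * q + e.
have Hq : program (Await, g, inord 0) =
    Test Work (at_label Divide g, None) (at_label Await g, Some forth).
  by rewrite /= inordK.
have await0 : at_label Await g = (Await, g, inord 0).
  by congr (_, _, _); apply: val_inj; rewrite /= inordK.
move Ed: (q - y) => d; elim: d y yq Ed => [|d IH] y yq Ed.
  have -> : y = q by lia.
  have U : uphalf (w + e + q) = 2 * q + e.
    have -> : w + e + q = (2 * q + e).*2 by rewrite /w -muln2; lia.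
    exact: uphalf_double.
  have O : odd (w + e + q) = false.
    have -> : w + e + q = (2 * q + e).*2 by rewrite /w -muln2; lia.
    exact: odd_double.
  rewrite /slow U O; have -> : w - (2 * q + e) = q by rewrite /w; lia.
  exact: (reach_catch Hq).
(* Before reaching the quotient the leader must not meet [Work]. *)
have U : w - uphalf (w + e + y) > y.
  by rewrite uphalf_half -divn2 /w; have := leq_b1 (odd (3 * q + e + e + y)); lia.
apply: (@reach_trans (slow (Await, g, inord 0) p y.+1 s w (w + e + y.+1)) _ _ 1 d.+1) => //.
  rewrite addnS; apply: (slow_step Hq) => //; last exact: along_forth.
  - by rewrite /= -divn2 /w; lia.
  - by lia.
  - by rewrite /= gtn_eqF // -await0.
by apply: IH; lia.
Qed.

Lemma divide_sync f p s w : sy -> 0 < w ->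
  reach (line (at_label Divide f) p w (s, 0, w, 0))
    (line (at_label Divide (fs f (inord (w %% 3)))) p (w %/ 3) (s, 0, w %/ 3, 0)) (17 * w).
Proof.
move=> sync w0; set q := w %/ 3; set e := w %% 3; set g := fs f _.
have wE : w = 3 * q + e by rewrite mulnC -divn_eq.
have e3 : e < 3 by rewrite ltn_mod.
apply: (@reach_trans (line (at_label Fire f) p w (s, 0, w, 0)) _ _ 1 (16 * w)); last by lia.
  apply: line_no; first by rewrite /= sync.
  by rewrite /= eq_sym -lt0n.
apply: (@reach_trans (slow (Inward, f, inord 1) p w.-1 s w 0) _ _ 1 (14 * w)); last by lia.
  rewrite /slow subn0 -(along_back _ p w.-1) prednK //.
  exact: (@reach_launch (at_label Fire f) _ (spread p (s, 0, w, 0))).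
apply: (@reach_trans (slow (Await, g, inord e) p 0 s w w) _ _ w (12 * w)); last by lia.
  by have := @inward f p s w w.-1 0; rewrite prednK //; apply.
apply: (@reach_trans (slow (Await, g, inord 0) p 0 s w (w + e)) _ _ e q.+1); last by lia.
  by apply: await => //; rewrite uphalf_half; lia.
have := @catch_up g p s q e 0 e3; rewrite -wE subn0 addn0.
exact.
Qed.

End Sync.

End Reach.

(** * Initial team and total cost *)

Definition team_init (i : 'I_team) : astate :=
  if role i is Some j then inr (j, None) else inl (at_label Count f0).

Lemma team_finds sched clk p k c : clk 0 = 0 ->
  reach team_init sched clk (line (at_label Count f0) (origin n) 0 (0, 0, 0, 0))
    (line (at_label Fetch f0) p 0 (k, 0, 0, 0)) c ->
  exists2 t, found agents team_init sched p t & clk t <= c.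
Proof.
move=> clk0 H; have [|t [Ht _] ct] := H 0.
  split=> i; last by rewrite /= /team_init; case: (role i) => [j|] //; rewrite if_same.
  by rewrite conf_pos /= !along0; case: (role i) => [[]|].
exists t; last by rewrite clk0 in ct.
have [i Hi] : exists i, role i = Some Base by apply: role_onto.
by exists i; rewrite Ht conf_pos Hi /= along0.
Qed.

End Machine.

Lemma sync_finds n (i0 : 'I_n) (F : finType) fs out (f0 : F) t :
  exists2 t', found (agents i0 fs out f0 true) (@team_init F f0 true)
    (@sync_sched (team true)) (walk fs out f0 t) t' & t' <= 3 + 357 * t ^ 2.
Proof.
have fairness : fair (@sync_sched (team true)).
  by move=> i u; exists u; rewrite inE.
have idle_ok : forall u i (c : config n (astate F) (team true)),
    ceq (run (agents i0 fs out f0 true) (@team_init F f0 true) (@sync_sched _) u) c ->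
    (forall i', i' != i -> idle i0 fs out f0 c i') -> u.+1 <= u + (i \in @sync_sched (team true) u).
  by move=> u i c _ _; rewrite inE addn1.
apply: (@team_finds n i0 F fs out f0 true _ id _ t.+1) => //.
(* The factor 21 is the price of a round, 17 that of a division. *)
apply: many_rounds => // s p s0; rewrite expn1 -[357]/(21 * 17) -mulnA.
apply: one_round => // f w /andP[w0 _].
exact: divide_sync.
Qed.

Lemma semi_finds n (i0 : 'I_n) (F : finType) fs out (f0 : F) t (sched : nat -> {set 'I_5}) :
  fair sched ->
  exists2 t', found (agents i0 fs out f0 false) (@team_init F f0 false)
    sched (walk fs out f0 t) t' &
    total_cost (agents i0 fs out f0 false) (@team_init F f0 false) sched t' <= 3 + 357 * t ^ 3.
Proof.
move=> fairness.
have idle_ok : forall u i (c : config n (astate F) (team false)),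
    ceq (run (agents i0 fs out f0 false) (@team_init F f0 false) sched u) c ->
    (forall i', i' != i -> idle i0 fs out f0 c i') ->
    total_cost (agents i0 fs out f0 false) (@team_init F f0 false) sched u.+1 <=
    total_cost (agents i0 fs out f0 false) (@team_init F f0 false) sched u + (i \in sched u).
  (* Idle agents travel no distance, so only [i] can contribute, and at most 1. *)
  move=> u i c Hc Hi; rewrite /total_cost big_ord_recr leq_add2l /= /step_cost.
  have [_ H2] := Hc.
  have idle0 i' : i' != i -> move_len (agents i0 fs out f0 false
      ((run (agents i0 fs out f0 false) (@team_init F f0 false) sched u).2 i')
      (observe (run (agents i0 fs out f0 false) (@team_init F f0 false) sched u) i')).2 = 0.
    by move=> ni; rewrite H2 (observe_ceq _ Hc) (Hi i' ni).
  have [iS|iS] := boolP (i \in sched u).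
    rewrite (bigD1 i) //= big1 ?addn0; first by rewrite /move_len; case: (_.2).
    by move=> i' /andP[_]; exact: idle0.
  rewrite big1 // => i' iS'; apply: idle0; apply: contraNneq iS => <-; exact: iS'.
apply: (@team_finds n i0 F fs out f0 false _ _ _ t.+1) => //; first by rewrite /total_cost big_ord0.
apply: many_rounds => // s p s0.
(* Here the price of division is [u = 17 * s]. *)
have -> : 357 * s ^ 2 = 21 * (17 * s * s) by rewrite expnS expn1; lia.
apply: one_round => //; first by rewrite muln_gt0.
by move=> f w ws; apply: divide_semi.
Qed.

Theorem theorem1p3 (n : nat) (hn : (0 < n)%N) :
  (exists (Q : finType) (delta : automaton n Q) (init : 'I_4 -> Q) (C : nat),
     forall x : cell n,
       exists t : nat,
         (t <= C * ballV n (dist x) ^ 2)%N /\ found delta init (@sync_sched 4) x t)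
  /\
  (exists (Q : finType) (delta : automaton n Q) (init : 'I_5 -> Q) (C : nat),
     forall x : cell n, forall sched : nat -> {set 'I_5}, fair sched ->
       exists t : nat,
         found delta init sched x t /\
         (total_cost delta init sched t <= C * ballV n (dist x) ^ 3)%N).
Proof.
have [F [fs [out [f0 [C HC]]]]] := curve_exists hn.
(* Since [C * V] is positive, the additive 3 is absorbed into 360 = 357 + 3. *)
have cost d t V : t < C * V -> 3 + 357 * t ^ d.+1 <= 360 * C ^ d.+1 * V ^ d.+1.
  move=> tV; rewrite -mulnA -expnMn.
  have ? : t ^ d.+1 <= (C * V) ^ d.+1 by rewrite leq_exp2r // ltnW.
  have ? : 0 < (C * V) ^ d.+1 by rewrite expn_gt0 (leq_ltn_trans (leq0n t) tV).
  by lia.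
pose i0 : 'I_n := Ordinal hn.
split.
  exists (astate F), (agents i0 fs out f0 true), (@team_init F f0 true), (360 * C ^ 2) => x.
  have [t tV tx] := HC x; have [t' ft' ct'] := sync_finds i0 fs out f0 t.
  exists t'; split; last by rewrite -tx.
  by apply: leq_trans ct' _; exact: cost.
exists (astate F), (agents i0 fs out f0 false), (@team_init F f0 false), (360 * C ^ 3).
move=> x sched Hs; have [t tV tx] := HC x.
have [t' ft' ct'] := semi_finds i0 fs out f0 t Hs.
exists t'; split; first by rewrite -tx.
by apply: leq_trans ct' _; exact: cost.
Qed.
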